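(* Let $\mathcal{F}$ be a hypothesis class of functions $f:\mathbf{X}\to\mathbf{Y}$ used for classification, where the label set $\mathbf{Y}$ is binary, and let $(\mathcal{L},\mathcal{O})$ be an active learning system for $\mathcal{F}$ in the query synthesis (QS) scenario with query complexity $q(\varepsilon,\delta)$. Let $D$ be any randomized procedure for returning labels such that there exists $f^*\in\mathcal{F}$ with $\rho_D(f^* )<\frac12$. Then there exists an adversary that, interacting with the server $S_D(f^* )$, implements an $\varepsilon$-extraction attack with confidence $1-2\delta$ and complexity $$q=\frac{8}{(1-2\rho_D(f^* ))^2}\,q(\varepsilon,\delta)\,\ln\frac{q(\varepsilon,\delta)}{\delta}.$$ That is, there is an adversary $\tilde{\mathcal{A}}$ making at most $q$ queries to $S_D(f^* )$ such that $\Pr[\mathrm{Exp}^{\varepsilon}_{\mathcal{F}}(S_D(f^* ),\tilde{\mathcal{A}},q)=1]\ge 1-2\delta$.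
   Context: **Error function.** An error function $\mathrm{Err}:\mathcal{F}\to\mathbb{R}$ is fixed in advance. It measures the error of a candidate $\hat f\in\mathcal{F}$ with respect to the true function $f^*\in\mathcal{F}$ held by the oracle/server, so its value may depend on $f^*$. **Active learning system, QS scenario.** The learner $\mathcal{L}$ is a (possibly randomized) interactive procedure. It adaptively generates arbitrary instances $x\in\mathbf{X}$ (each may depend on previous queries and answers) and sends them to the oracle. The oracle $\mathcal{O}_{f^*}$, where $f^*\in\mathcal{F}$, answers each query $x$ with $f^*(x)$. The learner eventually stops and outputs some $\hat f\in\mathcal{F}$. The pair $(\mathcal{L},\mathcal{O})$ is an active learning system for $\mathcal{F}$ in the QS scenario with query complexity $q(\varepsilon,\delta)$ (a positive integer) if, for every $f^*\in\mathcal{F}$, when $\mathcal{L}$ interacts with $\mathcal{O}_{f^*}$ using $q(\varepsilon,\delta)$ queries, it outputs $\hat f\in\mathcal{F}$ with $\mathrm{Err}(\hat f)\le\varepsilon$ with probability at least $1-\delta$. Here $\varepsilon,\delta\in(0,1)$. **Defended server.** $S_D(f^* )$ denotes a server that knows $f^*$ and answers each query $x\in\mathbf{X}$ with a label $\tilde y\in\mathbf{Y}$ computed by the randomized procedure $D$ (instead of answering $f^*(x)$). The answer to a query $x$ is distributed as a random variable $Y_x$, using fresh independent random coins of $D$ for every query (including repeated queries of the same $x$). Define $$\rho_D(f^*,x)=\Pr[Y_x\ne f^*(x)],\qquad \rho_D(f^* )=\sup_{x\in\mathbf{X}}\rho_D(f^*,x).$$ **Extraction experiment** $\mathrm{Exp}^{\varepsilon}_{\mathcal{F}}(S_D(f^*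 ),\mathcal{A},q)$. The adversary $\mathcal{A}$, who knows $\mathcal{F}$, sends at most $q$ (adaptive) queries to $S_D(f^* )$, receives its answers, and then outputs $\hat f$. The output of the experiment is $1$ if $\mathrm{Err}(\hat f)\le\varepsilon$ and $0$ otherwise. $\mathcal{A}$, interacting with $S_D(f^* )$, implements an $\varepsilon$-extraction attack with complexity $q$ and confidence $\gamma$ if $\Pr[\mathrm{Exp}^{\varepsilon}_{\mathcal{F}}(S_D(f^* ),\mathcal{A},q)=1]\ge\gamma$, with probability over the randomness of $\mathcal{A}$ and of $D$. The adversary may depend on $\varepsilon$, $\delta$ and $\rho_D(f^* )$. *)

(* Defs.v *)
From HB Require Import structures.
From mathcomp Require Import all_boot all_order all_algebra.
From mathcomp Require Import all_classical all_reals all_analysis.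
Set Implicit Arguments.
Unset Strict Implicit.
Unset Printing Implicit Defensive.
Import Order.TTheory GRing.Theory Num.Theory.
Import numFieldNormedType.Exports.
Local Open Scope classical_set_scope.
Local Open Scope ring_scope.

(* The n-fold power of a probability P, on n.-tuple T with the product
   sigma-algebra: P^0 is the point mass at the empty tuple, and P^(n+1) is the
   law of x :: t for (x, t) distributed as P \x P^n. *)
Section iid_probability.
Context d (T : measurableType d) (R : realType) (P : probability T R).

Definition tuple_cons n (p : T * n.-tuple T) : n.+1.-tuple T :=
  [the n.+1.-tuple T of p.1 :: p.2].

Lemma measurable_tuple_cons n : measurable_fun [set: T * n.-tuple T] (@tuple_cons n).
Proof. exact: measurable_cons. Qed.

HB.instance Definition _ n :=
  isMeasurableFun.Build _ _ _ _ (@tuple_cons n) (@measurable_tuple_cons n).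

Fixpoint iid_probability n : probability (n.-tuple T) R :=
  match n with
  | 0 => dirac ([tuple] : 0.-tuple T)
  | n'.+1 => distribution (P \x iid_probability n')%E (@tuple_cons n')
  end.

End iid_probability.

(* The instance space X carries a sigma-algebra, which is only used to make
   sense of probabilities; every set is allowed as X, with its discrete
   sigma-algebra if no other is meant.  A set F of functions is also the type
   of its elements, so that [Err : F -> F -> R] is an error function on F whose
   first argument is the true function and whose second is the candidate. *)
Section extraction.
Context (R : realType) (dX : measure_display) (X : measurableType dX).
Context (Y : finType) (F : set (X -> Y)).

(* A randomized interactive procedure draws its coins w once.  On the answers h
   received so far (oldest first), it either sends the query x, when
   [next w h = Some x], or stops, when [next w h = None], and then outputs
   [output w h].  The last two fields make the next query and the error of the
   output random variables. *)
Record procedure (Err : F -> F -> R) := Procedure {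
  pdisp : measure_display;
  pcoin : measurableType pdisp;
  pprob : probability pcoin R;
  next : pcoin -> seq Y -> option X;
  output : pcoin -> seq Y -> F;
  measurable_next : forall (h : seq Y) (B : set X), measurable B ->
    measurable [set w | exists2 x, B x & next w h = Some x];
  measurable_output : forall (f : F) (h : seq Y),
    measurable_fun [set: pcoin] (fun w => Err f (output w h))
}.

(* The answers received after at most n queries, when [ans i x] is the answer
   given if the i-th query (counted from 0) is x. *)
Fixpoint answers (nxt : seq Y -> option X) (ans : nat -> X -> Y) (n : nat) :
    seq Y :=
  if n is n'.+1 then
    let h := answers nxt ans n' in
    if nxt h is Some x then rcons h (ans n' x) else h
  else [::].

Definition halts Err (A : procedure Err) n (w : pcoin A) (ans : nat -> X -> Y)
  : Prop := next w (answers (next w) ans n) = None.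

Definition succeeds Err (A : procedure Err) (fstar : F) (eps : R) n
    (w : pcoin A) (ans : nat -> X -> Y) : Prop :=
  halts n w ans /\ Err fstar (output w (answers (next w) ans n)) <= eps.

(* Active learning system in the query synthesis scenario: the oracle for fstar
   answers every query x with fstar x. *)
Definition active_learning_system Err (L : R -> R -> procedure Err)
    (q : R -> R -> nat) : Prop :=
  forall eps delta : R, 0 < eps < 1 -> 0 < delta < 1 ->
    (0 < q eps delta)%N /\
    forall fstar : F,
      let E := [set w : pcoin (L eps delta) |
                 succeeds fstar eps (q eps delta) w (fun _ => \val fstar)] in
      measurable E /\ ((1 - delta)%:E <= pprob (L eps delta) E)%E.

(* A randomized labelling procedure: [label f x c] is the answer to the query x
   computed with coins c by a server that knows f. *)
Record defense := Defense {
  ddisp : measure_display;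
  dcoin : measurableType ddisp;
  dprob : probability dcoin R;
  label : F -> X -> dcoin -> Y;
  measurable_label : forall (f : F) (y : Y),
    measurable [set p : X * dcoin | label f p.1 p.2 = y]
}.

Definition rho_at (D : defense) (fstar : F) (x : X) : R :=
  fine (dprob D [set c | label fstar x c <> \val fstar x]).

Definition rho (D : defense) (fstar : F) : R := sup (range (rho_at D fstar)).

(* The i-th query is answered with the i-th coins of a tuple of n independent
   ones; answers past the n-th never matter and are set to fstar x. *)
Definition server (D : defense) (fstar : F) n (c : n.-tuple (dcoin D))
    (i : nat) (x : X) : Y :=
  if insub i is Some j then label fstar x (tnth c j) else \val fstar x.

(* The event that the extraction experiment with at most n queries outputs 1,
   over the coins of the adversary and of the server. *)
Definition experiment Err (D : defense) (fstar : F) (A : procedure Err)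
    (eps : R) n : set (pcoin A * n.-tuple (dcoin D)) :=
  [set p | succeeds fstar eps n p.1 (server fstar p.2)].

(* The complexity Q is a real number: at most Q queries means at most
   [Num.truncn Q] of them, whatever the answers. *)
Definition extraction_attack Err (D : defense) (fstar : F) (A : procedure Err)
    (eps Q gamma : R) : Prop :=
  let n := Num.truncn Q in
  let E := experiment (D := D) fstar (A := A) eps (n := n) in
  [/\ forall w ans, halts (A := A) n w ans,
      measurable E &
      (gamma%:E <= (pprob A \x iid_probability (dprob D) n) E)%E].

End extraction.

(* Main.v *)
(* Repeat every query of the learner m times, m = floor(8 ln(q/delta) / u^2)
   with u = 1 - 2 rho, and feed it the strict majority of the answers.  Fix the
   coins w of the learner: the queries it sends to the truthful oracle are then
   deterministic, so whether the i-th block of m answers outvotes the truth on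
   the i-th of these queries depends only on independent coins of the server, and
   by a Chernoff bound this has probability at most (1 - u^2/4)^m <= delta/q.
   Outside the union of these q events the simulated run is the truthful run, so
   integrating over w gives success probability at least (1 - delta)^2.  When
   delta >= 1/2, where m may be 0, the claimed confidence is at most 0. *)
Require Import Defs.
From HB Require Import structures.
From mathcomp Require Import all_boot all_order all_algebra.
From mathcomp Require Import all_classical all_reals all_analysis.
From mathcomp Require Import measurable_realfun ring lra zify.
Set Implicit Arguments.
Unset Strict Implicit.
Unset Printing Implicit Defensive.
Import Order.TTheory GRing.Theory Num.Theory.
Import numFieldNormedType.Exports.
Local Open Scope classical_set_scope.
Local Open Scope ring_scope.

(* [next] alone is [path.next]. *)
Local Notation next := Defs.next.

(** * Strict majorities and block-wise votes *)

Section majority_vote.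
Local Open Scope nat_scope.
Context (Y : eqType) (y0 : Y).

(** A strict majority label occurs in [s], so scanning [s] finds it; if there is none, [find] runs
    past the end and the value is [y0]. *)
Definition majority (s : seq Y) : Y :=
  nth y0 s (find (fun y => size s < 2 * count_mem y s) s).

(** Two distinct labels cannot both fill more than half of [s], as their counts sum to at most
    [size s]. *)
Lemma majorityP (s : seq Y) (y : Y) :
  size s < 2 * count_mem y s -> majority s = y.
Proof.
move=> ys; rewrite /majority; set P := fun y => _.
have hasP : has P s.
  apply/hasP; exists y => //.
  by rewrite -has_pred1 has_count -(ltn_pmul2l (isT : 0 < 2)); case: (size s) ys => // ; lia.
have := nth_find y0 hasP; set z := nth _ _ _; rewrite /P => zs.
apply/eqP/negP => /negP zy.
have : count_mem z s + count_mem y s <= size s.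
  have := count_predUI (pred1 z) (pred1 y) s.
  rewrite [X in _ + X = _](@eq_count _ _ pred0); last first.
    move=> t /=; apply/negP => /andP[/eqP -> /eqP zy'].
    by rewrite zy' eqxx in zy.
  by rewrite count_pred0 addn0 => <-; exact: count_size.
by move: zs ys; lia.
Qed.

(** Floor division drops a trailing unfinished block, and yields no votes when [m] is 0. *)
Definition block_votes m (h : seq Y) : seq Y :=
  mkseq (fun k => majority (take m (drop (k * m) h))) (size h %/ m).

Lemma block_votes_partial m (a b : seq Y) :
  m %| size a -> size b < m -> block_votes m (a ++ b) = block_votes m a.
Proof.
move=> /dvdnP[k ak] bm; have m0 : 0 < m by lia.
rewrite /block_votes size_cat ak divnMDl// divn_small// addn0 mulnK//.
apply/eq_in_map => i; rewrite mem_iota /= add0n => ik; congr majority.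
have im : i.+1 * m <= k * m by rewrite leq_mul2r ik orbT.
rewrite mulSn in im.
rewrite drop_cat ak; case: ltnP => [_|]; last by lia.
by rewrite takel_cat// size_drop ak; lia.
Qed.

Lemma block_votes_full m (a b : seq Y) : 0 < m ->
  m %| size a -> size b = m ->
  block_votes m (a ++ b) = rcons (block_votes m a) (majority b).
Proof.
move=> m0 /dvdnP[k ak] bm.
rewrite /block_votes size_cat ak bm addnC -mulSn !mulnK//.
rewrite mkseqS; congr rcons; last first.
  by rewrite drop_size_cat// take_oversize// bm.
apply/eq_in_map => i; rewrite mem_iota /= add0n => ik; congr majority.
have im : i.+1 * m <= k * m by rewrite leq_mul2r ik orbT.
rewrite mulSn in im.
rewrite drop_cat ak; case: ltnP => [_|]; last by lia.
by rewrite takel_cat// size_drop ak; lia.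
Qed.

End majority_vote.

(** * Query transcripts and simulation by repetition *)

Section answers_theory.
Local Open Scope nat_scope.
Context (dX : measure_display) (X : measurableType dX) (Y : finType).
Implicit Types (nxt : seq Y -> option X) (ans : nat -> X -> Y).

Lemma answers_stop nxt ans n p : nxt (answers nxt ans n) = None ->
  answers nxt ans (n + p) = answers nxt ans n.
Proof.
move=> nN; elim: p => [|p IH]; first by rewrite addn0.
by rewrite addnS /= IH nN.
Qed.

(** Each round adds one answer unless the procedure has stopped for good. The cap in [repeat_next]
    counts answers; this converts it into a cap on rounds. *)
Lemma size_answers_or_stop nxt ans n :
  size (answers nxt ans n) = n \/ nxt (answers nxt ans n) = None.
Proof.
elim: n => [|n [IH|IH]]; first by left.
- case E : (nxt (answers nxt ans n)) => [x|].
    by left; rewrite /= E size_rcons IH.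
  by right; rewrite /= E.
- by right; rewrite /= IH.
Qed.

Lemma answers_same_query nxt ans n x m :
  (forall b, size b < m -> nxt (answers nxt ans n ++ b) = Some x) ->
  answers nxt ans (n + m) =
    answers nxt ans n ++ mkseq (fun i => ans (n + i) x) m.
Proof.
move=> H.
suff: forall j, j <= m -> answers nxt ans (n + j) =
    answers nxt ans n ++ mkseq (fun i => ans (n + i) x) j by exact.
elim=> [|j IH] jm; first by rewrite addn0 cats0.
rewrite addnS /= IH ?(ltnW jm)// H ?size_mkseq//.
by rewrite mkseqS rcons_cat.
Qed.

Context (y0 : Y) (q m : nat).

(* Inside an unfinished block the votes, hence the query, do not change. *)
Definition repeat_next nxt (h : seq Y) : option X :=
  if size h < q * m then nxt (block_votes y0 m h) else None.

Lemma repeat_next_halts nxt ans n : q * m <= n ->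
  repeat_next nxt (answers (repeat_next nxt) ans n) = None.
Proof.
move=> qmn; case: (size_answers_or_stop (repeat_next nxt) ans n) => // sz.
by rewrite /repeat_next sz ltnNge qmn.
Qed.

(** The hypothesis concerns the queries of the truthful run; block by block, these turn out to be
    the queries that the simulation sends. *)
Lemma repeat_next_simulates nxt ans (f : X -> Y) k : 0 < m -> k <= q ->
  (forall i x, i < k -> nxt (answers nxt (fun _ => f) i) = Some x ->
    m < 2 * count_mem (f x) (mkseq (fun j => ans (i * m + j) x) m)) ->
  block_votes y0 m (answers (repeat_next nxt) ans (k * m)) =
    answers nxt (fun _ => f) k.
Proof.
move=> m0 kq votesP.
(* The invariant adds that a run still going has exactly [k * m] answers, so the next block starts
   on a block boundary and reads [ans] at [k * m + j]. *)
suff: block_votes y0 m (answers (repeat_next nxt) ans (k * m)) =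
        answers nxt (fun _ => f) k /\
      (size (answers (repeat_next nxt) ans (k * m)) = k * m \/
       nxt (answers nxt (fun _ => f) k) = None) by case.
elim: k kq votesP => [|k IH] kq votesP.
  by rewrite mul0n /= /block_votes div0n; split; [|left].
have [ik] := IH (ltnW kq) (fun i x ik => votesP i x (ltnW ik)).
rewrite [k.+1 * m]mulSn addnC.
set h := answers (repeat_next nxt) ans (k * m) in ik *.
case E : (nxt (answers nxt (fun _ => f) k)) => [x|] => sz.
- have {}sz : size h = k * m by case: sz.
  have kmq : k.+1 * m <= q * m by rewrite leq_mul2r kq orbT.
  rewrite mulSn in kmq.
  rewrite (@answers_same_query _ _ _ x); last first.
    move=> b bm; rewrite -/h /repeat_next size_cat sz ifT; last by lia.
    by rewrite block_votes_partial// ?sz ?dvdn_mull// ik.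
  rewrite -/h; split; last by left; rewrite size_cat size_mkseq sz.
  rewrite block_votes_full// ?sz ?dvdn_mull// ?size_mkseq// ik /= E.
  congr rcons; apply: majorityP; rewrite size_mkseq.
  exact: votesP.
- rewrite answers_stop -/h; last first.
    by rewrite /repeat_next ik E if_same.
  by rewrite /= E ik; split => //; right.
Qed.

Lemma repeat_next_votes nxt ans (f : X -> Y) n : 0 < m -> q * m <= n ->
  (forall i x, i < q -> nxt (answers nxt (fun _ => f) i) = Some x ->
    m < 2 * count_mem (f x) (mkseq (fun j => ans (i * m + j) x) m)) ->
  block_votes y0 m (answers (repeat_next nxt) ans n) =
    answers nxt (fun _ => f) q.
Proof.
move=> m0 qmn votesP; rewrite -(subnKC qmn) answers_stop.
  exact: repeat_next_simulates.
exact: repeat_next_halts.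
Qed.

End answers_theory.

(** * Measurability of the extraction experiment *)

Section experiment_measurability.
Context (R : realType) (dX : measure_display) (X : measurableType dX).
Context (Y : finType) (F : set (X -> Y)) (Err : F -> F -> R).
Implicit Types (A : procedure Err) (D : defense R F).

Lemma measurable_next_None A h : measurable [set w : pcoin A | next w h = None].
Proof.
have -> : [set w : pcoin A | next w h = None] =
    ~` [set w | exists2 x, [set: X] x & next w h = Some x].
  apply/seteqP; split => [w /= wN [x _]|w /= wN]; first by rewrite wN.
  by case E : (next w h) => [x|//]; exfalso; apply: wN; exists x.
by apply: measurableC; exact: measurable_next.
Qed.

(** Totalizing the partial query lets it be composed with measurable maps; stopped coins lie in the
    preimage of [B] exactly when [B] contains [point]. *)
Lemma measurable_next_default A h :
  measurable_fun [set: pcoin A] (fun w => odflt point (next w h)).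
Proof.
move=> _ B mB; rewrite setTI.
have [Bp|Bp] := pselect (B point).
- have -> : (fun w : pcoin A => odflt point (next w h)) @^-1` B =
      [set w | exists2 x, B x & next w h = Some x] `|`
      [set w | next w h = None].
    apply/seteqP; split => w /=.
      by case: (next w h) => [x|] /= Bx; [left; exists x|right].
    by case=> [[x Bx ->]|->].
  by apply: measurableU; [exact: measurable_next|exact: measurable_next_None].
- have -> : (fun w : pcoin A => odflt point (next w h)) @^-1` B =
      [set w | exists2 x, B x & next w h = Some x].
    apply/seteqP; split => w /=; last by case=> x Bx ->.
    by case: (next w h) => [x|] //= Bx; exists x.
  exact: measurable_next.
Qed.

(** [label] is jointly measurable in query and coins, so the event is a preimage under the pair of
    the totalized query and the [i]-th coin, restricted to where a query is sent. *)
Lemma measurable_answer A D fstar n (i : 'I_n) h y :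
  measurable [set p : pcoin A * n.-tuple (dcoin D) |
    exists2 x, next p.1 h = Some x & server fstar p.2 i x = y].
Proof.
pose g (p : pcoin A * n.-tuple (dcoin D)) :=
  (odflt point (next p.1 h), tnth p.2 i).
have mg : measurable_fun [set: pcoin A * n.-tuple (dcoin D)] g.
  apply: measurable_fun_pair.
    exact: measurableT_comp (measurable_next_default h) measurable_fst.
  exact: measurableT_comp (measurable_tnth i) measurable_snd.
have -> : [set p : pcoin A * n.-tuple (dcoin D) |
      exists2 x, next p.1 h = Some x & server fstar p.2 i x = y] =
    (fst @^-1` (~` [set w : pcoin A | next w h = None])) `&`
    (g @^-1` [set p | label fstar p.1 p.2 = y]).
  apply/seteqP; split => p /=; rewrite /server /g valK.
    by case=> x -> <-; split.
  by case: (next p.1 h) => [x|] /= [] => [_ <-|]; [exists x|].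
apply: measurableI.
  rewrite -[X in measurable X]setTI; apply: measurable_fst => //.
  by apply: measurableC; exact: measurable_next_None.
rewrite -[X in measurable X]setTI; apply: mg => //.
exact: measurable_label.
Qed.

(** After one more round the history is [h] either because the run had already stopped at [h], or
    because the last letter of [h] was just answered, with the [k]-th coin. *)
Lemma measurable_answers A D fstar n k h : (k <= n)%N ->
  measurable [set p : pcoin A * n.-tuple (dcoin D) |
    answers (next p.1) (server fstar p.2) k = h].
Proof.
elim: k h => [|k IH] h kn.
  have [->|h0] := pselect (h = [::]).
    by rewrite (_ : mkset _ = setT)//; apply/seteqP; split.
  rewrite (_ : mkset _ = set0)//; apply/seteqP; split => // p /=.
  by move=> /esym.
pose stop := [set p : pcoin A * n.-tuple (dcoin D) |
    answers (next p.1) (server fstar p.2) k = h] `&`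
  (fst @^-1` [set w : pcoin A | next w h = None]).
have mstop : measurable stop.
  apply: measurableI; first exact: IH (ltnW kn).
  rewrite -[X in measurable X]setTI; apply: measurable_fst => //.
  exact: measurable_next_None.
case/lastP: h @stop mstop => [|h y] stop mstop.
  rewrite (_ : mkset _ = stop)//; apply/seteqP; split => p /=.
    case E : (next p.1 _) => [x|] => [/(congr1 size)|h0].
      by rewrite size_rcons.
    by split => //=; rewrite -h0.
  by case=> /= ->; move=> ->.
rewrite (_ : mkset _ = stop `|` ([set p : pcoin A * n.-tuple (dcoin D) |
    answers (next p.1) (server fstar p.2) k = h] `&`
  [set p | exists2 x, next p.1 h = Some x & server fstar p.2 k x = y])).
  apply: measurableU => //; apply: measurableI; first exact: IH (ltnW kn).
  exact: (measurable_answer fstar (Ordinal kn)).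
apply/seteqP; split => p /=.
  case E : (next p.1 _) => [x|] => [/rcons_inj[= ah ay]|ah]; [right|left].
    by split=> //; exists x; rewrite -?ah.
  by split => //=; rewrite -ah.
case=> [[/= -> ->]//|[-> [x -> <-]]//].
Qed.

(** Histories over a finite label set are countably many, so the event is a countable union over the
    final history. *)
Lemma measurable_experiment A D fstar eps n :
  measurable (experiment (D := D) fstar (A := A) eps (n := n)).
Proof.
have -> : experiment (D := D) fstar (A := A) eps (n := n) =
    \bigcup_h ([set p | answers (next p.1) (server fstar p.2) n = h] `&`
      (fst @^-1` ([set w : pcoin A | next w h = None] `&`
                  [set w | Err fstar (output w h) <= eps]))).
  apply/seteqP; split => p /=.
    by case=> pN pE; exists (answers (next p.1) (server fstar p.2) n).
  by case=> h _ [/= ah [hN hE]]; split; rewrite /halts ah.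
apply: countable_bigcupT_measurable => [|h]; first exact: countableP.
apply: measurableI; first exact: measurable_answers.
rewrite -[X in measurable X]setTI; apply: measurable_fst => //.
apply: measurableI; first exact: measurable_next_None.
rewrite (_ : mkset _ = [set: pcoin A] `&`
    (fun w => Err fstar (output w h)) @^-1` `]-oo, eps]).
  by apply: measurable_output.
by rewrite setTI; apply/seteqP; split => w /=; rewrite in_itv.
Qed.

End experiment_measurability.

(** * A Chernoff bound for independent coins *)

Section iid_concentration.
Context d (T : measurableType d) (R : realType) (P : probability T R).

Lemma measurable_prod_tnth n (g : 'I_n -> T -> R) :
  (forall i, measurable_fun [set: T] (g i)) ->
  measurable_fun [set: n.-tuple T] (fun t => \prod_(i < n) g i (tnth t i)).
Proof.
move=> mg; apply: (@measurable_prod _ _ _ _ _ _ (fun i t => g i (tnth t i))).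
by move=> i _; exact: measurableT_comp (mg i) (measurable_tnth i).
Qed.

(** Independence enters here: Tonelli splits off the first coordinate, and induction bounds the
    integral over the tail. *)
Lemma integral_iid_prod_le n (g : 'I_n -> T -> R) (v : 'I_n -> R) :
  (forall i, measurable_fun [set: T] (g i)) ->
  (forall i x, 0 <= g i x) -> (forall i, 0 <= v i) ->
  (forall i, \int[P]_x (g i x)%:E <= (v i)%:E)%E ->
  (\int[iid_probability P n]_t (\prod_(i < n) g i (tnth t i))%:E <=
    (\prod_(i < n) v i)%:E)%E.
Proof.
move=> mg g0 v0 gv; elim: n g v mg g0 v0 gv => [|n IH] g v mg g0 v0 gv.
  rewrite [iid_probability P 0]/= integral_dirac//; last first.
    by apply/measurable_EFinP; exact: measurable_prod_tnth.
  by rewrite diracT mul1e !big_ord0.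
rewrite [iid_probability P n.+1]/= ge0_integral_distribution; last 2 first.
- by apply/measurable_EFinP; exact: measurable_prod_tnth.
- by move=> t; rewrite lee_fin; apply: prodr_ge0 => *.
pose G (t : n.-tuple T) := \prod_(i < n) g (lift ord0 i) (tnth t i).
have G0 t : 0 <= G t by apply: prodr_ge0 => *.
have mG : measurable_fun [set: n.-tuple T] G.
  exact: (measurable_prod_tnth (g := fun i => g (lift ord0 i))).
have -> : (fun t : n.+1.-tuple T => (\prod_(i < n.+1) g i (tnth t i))%:E) \o
    @tuple_cons _ T n = fun p => (g ord0 p.1 * G p.2)%:E.
  apply/funext => p /=; rewrite big_ord_recl; congr (_ * _)%:E.
  by apply: eq_bigr => i _; rewrite tnthS.
rewrite fubini_tonelli1/=; last 2 first.
- apply/measurable_EFinP; apply: measurable_funM.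
    exact: measurableT_comp (mg _) measurable_fst.
  exact: measurableT_comp mG measurable_snd.
- by move=> p; rewrite lee_fin mulr_ge0.
rewrite /fubini_F /= big_ord_recl.
have IHG : (\int[iid_probability P n]_t (G t)%:E <=
    (\prod_(i < n) v (lift ord0 i))%:E)%E.
  exact: (IH (fun i => g (lift ord0 i))).
have vG0 : 0 <= \prod_(i < n) v (lift ord0 i) by apply: prodr_ge0 => *.
apply: (@le_trans _ _ (\int[P]_x
    ((\prod_(i < n) v (lift ord0 i))%:E * (g ord0 x)%:E))%E).
  apply: ge0_le_integral => //.
  - by move=> x _; apply: integral_ge0 => t _; rewrite lee_fin mulr_ge0.
  - under eq_fun do under eq_integral do rewrite EFinM.
    under eq_fun => x.
      rewrite ge0_integralZl_EFin//; last 2 first.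
      - by move=> t _; rewrite lee_fin.
      - by apply/measurable_EFinP.
      over.
    apply: emeasurable_funM => //; apply/measurable_EFinP; exact: mg.
  - by apply/measurable_EFinP; apply: measurable_funM.
  - move=> x _; under eq_integral do rewrite EFinM.
    rewrite ge0_integralZl_EFin//; last 2 first.
    - by move=> t _; rewrite lee_fin.
    - by apply/measurable_EFinP.
    by rewrite muleC lee_wpmul2r// lee_fin.
rewrite ge0_integralZl_EFin//; last 2 first.
- by move=> x _; rewrite lee_fin.
- by apply/measurable_EFinP; exact: mg.
by rewrite mulrC EFinM lee_wpmul2l// lee_fin.
Qed.

(* The exponential moment p s + (1 - p) / s of one vote, p = (1 - u) / 2, at the
   rational s = 1 + u / 2: unlike the optimal sqrt((1 - p) / p), it also makes
   sense for p = 0, and the constant 8 leaves enough room for it. *)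
Lemma chernoff_factor_le (u : R) : 0 < u -> u <= 1 ->
  (1 + u / 2)^-1 + (1 + u / 2 - (1 + u / 2)^-1) * ((1 - u) / 2) <=
    1 - u ^+ 2 / 4.
Proof.
move=> u0 u1; set s := 1 + u / 2.
have s0 : 0 < s by rewrite /s; lra.
rewrite -(ler_pM2r s0) mulrDl mulVf ?gt_eqF// mulrAC mulrBl mulVf ?gt_eqF//.
by rewrite /s; nra.
Qed.

(** Markov's inequality for the exponential moment of the votes in [W] minus those outside; a tie
    belongs to [E]. *)
Lemma iid_half_or_more_le n (J : pred 'I_n) (W : set T) (u : R) :
  measurable W -> 0 < u -> u <= 1 -> (P W <= ((1 - u) / 2)%:E)%E ->
  let E := [set t : n.-tuple T |
    (#|J| <= 2 * \sum_(i | J i) (tnth t i \in W))%N] in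
  measurable E /\ (iid_probability P n E <= ((1 - u ^+ 2 / 4) ^+ #|J|)%:E)%E.
Proof.
move=> mW u0 u1 PW E.
pose s := 1 + u / 2.
have s1 : 1 < s by rewrite /s; lra.
have s0 : 0 < s by exact: lt_trans s1.
have sV1 : s^-1 < 1 by rewrite invf_lt1.
have sV0 : 0 < s^-1 by rewrite invr_gt0.
(* A vote indexed by [J] contributes [s] inside [W] and [s^-1] outside; other coordinates contribute
   1. *)
pose g (i : 'I_n) x := if J i then s^-1 + (s - s^-1) * \1_W x else 1.
have mg i : measurable_fun [set: T] (g i).
  rewrite /g; case: (J i) => //; apply: measurable_funD => //.
  by apply: measurable_funM => //; exact: measurable_indic.
have indic01 x : 0 <= \1_W x :> R by rewrite indicE.
have g0 i x : 0 <= g i x.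
  rewrite /g; case: (J i) => //; rewrite addr_ge0 ?(ltW sV0)// mulr_ge0// subr_ge0.
  by rewrite (le_trans (ltW sV1))// ltW.
pose G (t : n.-tuple T) := \prod_(i < n) g i (tnth t i).
have mG : measurable_fun [set: n.-tuple T] G by exact: measurable_prod_tnth.
have G0 t : 0 <= G t by apply: prodr_ge0 => *.
(* Multiplying by [s ^+ #|J|] keeps the exponents natural. *)
have GE t : G t * s ^+ #|J| = s ^+ (2 * \sum_(i | J i) (tnth t i \in W)).
  have -> : s ^+ #|J| = \prod_(i | J i) s by rewrite prodr_const.
  rewrite big_mkcond /G -big_split/= big_distrr/= expr_sum [RHS]big_mkcond.
  apply: eq_bigr => i _; rewrite /g /=.
  case: ifP => Ji; last by rewrite mulr1.
  rewrite indicE; case: (tnth t i \in W).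
    by rewrite mulr1 addrC subrK expr2.
  by rewrite mulr0 addr0 mulVf ?gt_eqF.
(* As [s > 1], at least half of the votes lie in [W] exactly when [G t >= 1]. *)
have EG : E = G @^-1` `[1, +oo[.
  apply/seteqP; rewrite /E; split => t /=; rewrite in_itv/= andbT;
    by rewrite -(ler_eXn2l s1) -GE ler_pMl// exprn_gt0.
have mE : measurable E by rewrite EG -[X in measurable X]setTI; exact: mG.
split => //.
have -> : (1 - u ^+ 2 / 4) ^+ #|J| =
    \prod_(i < n) (if J i then 1 - u ^+ 2 / 4 else 1).
  by rewrite -big_mkcond prodr_const.
apply: (@le_trans _ _ (\int[iid_probability P n]_t (G t)%:E)%E).
  rewrite -[X in iid_probability P n X]setIT -integral_indic//.
  apply: ge0_le_integral => //.
  - by apply/measurable_EFinP; exact: measurable_indic.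
  - by apply/measurable_EFinP.
  - move=> t _; rewrite lee_fin indicE; case: (boolP (t \in E)) => //.
    by rewrite inE EG /= in_itv /= andbT.
apply: integral_iid_prod_le => // i; first by case: (J i) => //; nra.
rewrite /g; case: (J i); last first.
  by rewrite integral_cst// mul1e probability_le1.
under eq_integral do rewrite EFinD EFinM.
have ds : 0 <= s - s^-1 by rewrite subr_ge0 ltW// (lt_trans sV1).
rewrite ge0_integralD//; last 3 first.
- by move=> x _; rewrite lee_fin ltW.
- by move=> x _; rewrite -EFinM lee_fin mulr_ge0.
- apply: emeasurable_funM => //; apply/measurable_EFinP.
  exact: measurable_indic.
have -> : (\int[P]_x (s^-1)%:E = (s^-1)%:E)%E.
  rewrite integral_cst// -[RHS]mule1; congr (_ * _)%E.
  exact: probability_setT.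
rewrite ge0_integralZl_EFin//; last first.
  by apply/measurable_EFinP; exact: measurable_indic.
rewrite integral_indic// setIT.
have := chernoff_factor_le u0 u1; rewrite -lee_fin; apply: le_trans.
rewrite [leRHS]EFinD leeD2l// [leRHS]EFinM lee_wpmul2l// lee_fin.
Qed.

End iid_concentration.

(** * Counting over a block of coin indices *)

Section block_errors.
Local Open Scope nat_scope.

Lemma sum_ord_window (F : nat -> nat) n a m : a + m <= n ->
  \sum_(k < n | a <= k < a + m) F k = \sum_(j < m) F (a + j).
Proof.
move=> amn.
rewrite -(big_mkord xpredT (fun j => F (a + j))).
rewrite -(big_mkord (fun k => a <= k < a + m) F).
rewrite (big_cat_nat _ _ (n := a)) ?(leq_trans (leq_addr m a))//=.
rewrite big_nat_cond big_pred0 ?add0n; last first.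
  by move=> k; apply/negbTE/negP => /andP[/andP[_ +] /andP[+ _]]; lia.
rewrite (big_cat_nat _ _ (n := a + m)) ?leq_addr//= addnC.
rewrite big_nat_cond big_pred0 ?add0n; last first.
  by move=> k; apply/negbTE/negP => /andP[/andP[+ _] /andP[_ +]]; lia.
rewrite big_nat_cond (eq_bigl (fun k => (a <= k < a + m) && true)); last first.
  by move=> k; case: (a <= k < a + m).
rewrite -big_nat_cond -{1}(add0n a) big_addn addKn.
by apply: eq_bigr => j _; rewrite addnC.
Qed.

Lemma count_mkseq (T : Type) (p : pred T) (g : nat -> T) m :
  count p (mkseq g m) = \sum_(j < m) p (g j).
Proof.
rewrite count_map -sum1_count big_mkcond -{1}(subn0 m) -/(index_iota 0 m).
by rewrite big_mkord; apply: eq_bigr => j _ /=; case: (p _).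
Qed.

End block_errors.

(** * Repeated queries against the defended server *)

Section repeated_queries.
Context (R : realType) (dX : measure_display) (X : measurableType dX).
Context (Y : finType) (F : set (X -> Y)) (Err : F -> F -> R).

Lemma measurable_wrong_label (D : defense R F) fstar x :
  measurable [set c | label (d := D) fstar x c <> \val fstar x].
Proof.
apply: measurableC; rewrite -[X in measurable X]setTI.
exact: (pair1_measurable x measurableT
  (measurable_label (d := D) fstar (\val fstar x))).
Qed.

(** Error rates are probabilities, hence bounded by 1, so their real supremum is a genuine upper
    bound. *)
Lemma wrong_label_le_rho (D : defense R F) fstar x :
  (dprob D [set c | label fstar x c <> \val fstar x] <= (rho D fstar)%:E)%E.
Proof.
have mW := measurable_wrong_label D fstar x.
rewrite -[leLHS]fineK ?fin_num_measure// lee_fin.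
apply: ub_le_sup; last by exists x.
exists 1 => _ [z _ <-]; rewrite /rho_at -lee_fin fineK ?probability_le1//.
  exact: measurable_wrong_label.
by rewrite fin_num_measure//; exact: measurable_wrong_label.
Qed.

Lemma rho_ge0 (D : defense R F) fstar : 0 <= rho D fstar.
Proof. by rewrite -lee_fin; apply: le_trans (wrong_label_le_rho D fstar point). Qed.

(** The truth lacks a strict majority exactly when at least half of the block is wrong, so
    [iid_half_or_more_le] applies with [J] the indices of the [i]-th block and [W] the coins giving
    a wrong label. *)
Lemma lost_vote_le (D : defense R F) fstar n i m x :
  rho D fstar < 1 / 2 -> (i * m + m <= n)%N ->
  let B := [set t : n.-tuple (dcoin D) |
    ~ (m < 2 * count_mem (\val fstar x)
                 (mkseq (fun j => server fstar t (i * m + j) x) m))%N] in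
  measurable B /\ (iid_probability (dprob D) n B <=
    ((1 - (1 - 2 * rho D fstar) ^+ 2 / 4) ^+ m)%:E)%E.
Proof.
move=> rho2 imn B.
pose W := [set c | label (d := D) fstar x c <> \val fstar x].
pose J := [pred k : 'I_n | (i * m <= k < i * m + m)%N].
have cJ : #|J| = m.
  rewrite -sum1_card (@sum_ord_window (fun=> 1%N))//.
  by rewrite sum_nat_const card_ord muln1.
have := @iid_half_or_more_le _ _ _ (dprob D) n J W (1 - 2 * rho D fstar).
rewrite cJ.
suff <- : B = [set t : n.-tuple (dcoin D) |
    (m <= 2 * \sum_(k | J k) (tnth t k \in W))%N].
  apply; first exact: measurable_wrong_label.
  - by lra.
  - by have := rho_ge0 D fstar; lra.
  - by rewrite (_ : _ / 2 = rho D fstar); [exact: wrong_label_le_rho|lra].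
have countE (t : n.-tuple (dcoin D)) :
    (count_mem (\val fstar x) (mkseq (fun j => server fstar t (i * m + j) x) m)
     + \sum_(k | J k) (tnth t k \in W) = m)%N.
  rewrite count_mkseq.
  pose G k : nat := server fstar t k x != \val fstar x.
  rewrite [X in (_ + X)%N](_ : _ = \sum_(k < n | J k) G k)%N; last first.
    apply: eq_bigr => k _; rewrite /G /server valK; congr nat_of_bool.
    by apply/idP/idP; rewrite inE => /eqP.
  rewrite (@sum_ord_window G)// -big_split/=.
  rewrite (eq_bigr (fun=> 1%N)); first by rewrite sum_nat_const card_ord muln1.
  by move=> j _; rewrite /G; case: (_ == _).
apply/seteqP; split => t; rewrite /B /mkset; have := countE t;
  move: (count_mem _ _) (\sum_(k | J k) _)%N => right wrong; last by lia.
by move=> <- /negP; lia.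
Qed.

Variable y0 : Y.

Program Definition repeat_queries (L : procedure Err) (q m : nat) :
    procedure Err :=
  @Procedure R dX X Y F Err (pdisp L) (pcoin L) (pprob L)
    (fun w => repeat_next y0 q m (next w))
    (fun w h => output w (block_votes y0 m h)) _ _.
Next Obligation.
move=> L q m h B mB; rewrite /repeat_next; case: (size h < q * m)%N.
  exact: measurable_next.
by rewrite (_ : mkset _ = set0)//; apply/seteqP; split => // w [].
Qed.
Next Obligation. by move=> L q m f h; exact: measurable_output. Qed.

Lemma repeat_queries_success (L : procedure Err) (D : defense R F) fstar
    (eps delta : R) (q m n : nat) (w : pcoin L) :
  rho D fstar < 1 / 2 -> (0 < q)%N -> (0 < m)%N -> (q * m <= n)%N ->
  (1 - (1 - 2 * rho D fstar) ^+ 2 / 4) ^+ m <= delta / q%:R ->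
  succeeds fstar eps q w (fun _ => \val fstar) ->
  ((1 - delta)%:E <= iid_probability (dprob D) n (xsection
    (experiment (D := D) fstar (A := repeat_queries L q m) eps (n := n)) w))%E.
Proof.
move=> rho2 q0 m0 qmn failm [Lhalt Lsucc].
set E := experiment _ _.
(* The query is read off the truthful run, so it does not depend on the server's coins [t]; once
   that run has stopped there is no vote to lose. *)
pose B i := if next w (answers (next w) (fun _ => \val fstar) i) is Some x
  then [set t : n.-tuple (dcoin D) |
    ~ (m < 2 * count_mem (\val fstar x)
                 (mkseq (fun j => server fstar t (i * m + j) x) m))%N]
  else set0.
have BP i : (i < q)%N -> measurable (B i) /\
    (iid_probability (dprob D) n (B i) <= (delta / q%:R)%:E)%E.
  move=> iq; rewrite /B.
  have imn : (i * m + m <= n)%N.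
    by rewrite addnC -mulSn; apply: leq_trans qmn; rewrite leq_mul2r iq orbT.
  case: (next w _) => [x|].
    have [mB Bfail] := @lost_vote_le D fstar n i m x rho2 imn.
    by split => //; apply: le_trans Bfail _; rewrite lee_fin.
  split => //; rewrite measure0 lee_fin; apply: le_trans failm.
  rewrite exprn_ge0//; have := rho_ge0 D fstar; nra.
pose U := \big[setU/set0]_(i < q) B i.
have mU : measurable U.
  by apply: bigsetU_measurable => i _; have [] := BP i (ltn_ord i).
have Udelta : (iid_probability (dprob D) n U <= delta%:E)%E.
  apply: le_trans (Boole_inequality _ _) _ => [i iq|]; first by case: (BP i iq).
  apply: (@le_trans _ _ (\sum_(i < q) (delta / q%:R)%:E)%E).
    by apply: lee_sum => i _; case: (BP i (ltn_ord i)).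
  rewrite sumEFin lee_fin sumr_const card_ord -[leLHS]mulr_natr divfK//.
  by rewrite pnatr_eq0 -lt0n.
(* Outside [U] every vote is won, so the votes reproduce the truthful transcript and the attack
   succeeds. *)
apply: (@le_trans _ _ (iid_probability (dprob D) n (~` U))).
  by rewrite probability_setC// EFinB leeB.
apply: le_measure; rewrite ?inE.
- exact: measurableC.
- by apply: measurable_xsection; exact: measurable_experiment.
move=> t tU; rewrite /xsection /= inE.
have votes : block_votes y0 m
    (answers (repeat_next y0 q m (next w)) (server fstar t) n) =
    answers (next w) (fun _ => \val fstar) q.
  apply: repeat_next_votes => // i x iq ix; apply: contrapT => lost.
  apply: tU; rewrite /U -bigcup_mkord; exists i => //.
  by rewrite /B ix.
split; first exact: repeat_next_halts.
by rewrite /= votes.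
Qed.

End repeated_queries.

(** Integrate the section measures over [A] alone: there they are at least [b], and elsewhere they
    are nonnegative. *)
Lemma product_probability_ge d1 d2 (T1 : measurableType d1)
    (T2 : measurableType d2) (R : realType) (P : probability T1 R)
    (Q : probability T2 R) (A : set T1) (E : set (T1 * T2)) (a b : R) :
  measurable A -> measurable E -> 0 <= a -> 0 <= b ->
  (a%:E <= P A)%E -> (forall x, A x -> (b%:E <= Q (xsection E x))%E) ->
  ((a * b)%:E <= (P \x Q) E)%E.
Proof.
move=> mA mE a0 b0 aP bQ.
have -> : ((P \x Q) E = \int[P]_x Q (xsection E x))%E by [].
have mQ : measurable_fun [set: T1] (fun x => Q (xsection E x)).
  exact: measurable_fun_xsection.
apply: (@le_trans _ _ (\int[P]_(x in A) Q (xsection E x))%E); last first.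
  by apply: ge0_subset_integral.
apply: (@le_trans _ _ (\int[P]_(x in A) cst b%:E x)%E); last first.
  by apply: ge0_le_integral => //; exact: measurable_funS mQ.
by rewrite integral_cst// mulrC EFinM lee_wpmul2l// lee_fin.
Qed.

(** * Estimates for the number of repetitions *)

Section repetition_count.
Context (R : realType).

(** By [ln (1 + t) <= t] at [t = x^-1 - 1], one has [- ln x <= x^-1 - 1 <= - 1 / 2]. *)
Lemma ln_ge_half (x : R) : 2 <= x -> 1 / 2 <= ln x.
Proof.
move=> x2; have x0 : 0 < x by lra.
have : ln (x^-1) <= x^-1 - 1.
  rewrite -{1}(subrKC 1 x^-1); apply: le_ln1Dx.
  by have : 0 < x^-1; [rewrite invr_gt0|lra].
rewrite lnV ?posrE//.
have : x^-1 <= 2^-1 by rewrite lef_pV2 ?posrE.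
lra.
Qed.

(** The integer part exceeds [x - 1] and is at least 1; add the two bounds. *)
Lemma truncn_ge_half (x : R) : 1 <= x -> x / 2 <= (Num.truncn x)%:R.
Proof.
move=> x1; have := truncnS_gt x; rewrite -natr1.
have : 1 <= (Num.truncn x)%:R :> R by rewrite ler1n truncn_gt0.
lra.
Qed.

(** Raise [1 - p <= expR (- p)] to the power [m]. *)
Lemma pow_one_minus_le (p y : R) m : 0 <= p -> p <= 1 -> 0 < y ->
  ln y <= p * m%:R -> (1 - p) ^+ m <= y^-1.
Proof.
move=> p0 p1 y0 yp.
have -> : y^-1 = expR (- ln y) by rewrite expRN lnK.
apply: (@le_trans _ _ (expR (- p) ^+ m)).
  by rewrite lerXn2r ?nnegrE ?expR_ge0 ?subr_ge0// expR_ge1Dx.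
by rewrite -expRM_natr ler_expR mulNr lerN2.
Qed.

End repetition_count.

(** * Choice of the repetition count and conclusion *)

Theorem proposition1 (R : realType) (dX : measure_display)
  (X : measurableType dX) (Y : finType) (hY : #|{: Y}| = 2%N)
  (F : set (X -> Y)) (Err : F -> F -> R)
  (L : R -> R -> procedure Err) (q : R -> R -> nat)
  (hL : active_learning_system L q)
  (eps delta r : R) (heps : 0 < eps < 1) (hdelta : 0 < delta < 1)
  (hr : r < 1 / 2) :
  exists A : procedure Err,
    forall (D : defense R F) (fstar : F), rho D fstar = r ->
      extraction_attack D fstar A eps
        (8 / (1 - 2 * r) ^+ 2 * (q eps delta)%:R
           * ln ((q eps delta)%:R / delta))
        (1 - 2 * delta).
Proof.
have /card_gt0P[y0 _] : (0 < #|{: Y}|)%N by rewrite hY.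
have [q0 Lsucc] := hL _ _ heps hdelta.
move: (hdelta) => /andP[d0 d1].
set Q := q eps delta in q0 Lsucc *; set l := ln _; set u := 1 - 2 * r.
have u0 : 0 < u by rewrite /u; lra.
have u20 : 0 < u ^+ 2 by rewrite exprn_gt0.
have Q1 : 1 <= Q%:R :> R by rewrite ler1n.
have l0 : 0 <= l by apply: ln_ge0; rewrite ler_pdivlMr// mul1r (le_trans (ltW d1)).
have c0 : 0 < 8 / u ^+ 2 by rewrite divr_gt0.
(* [m] depends only on [eps], [delta] and [r], so the adversary is fixed before [D] and [fstar]. *)
pose m := Num.truncn (8 / u ^+ 2 * l).
have mle : m%:R <= 8 / u ^+ 2 * l by rewrite truncn_le mulr_ge0// ltW.
exists (repeat_queries y0 (L eps delta) Q m) => D fstar rhor.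
set n := Num.truncn (8 / u ^+ 2 * Q%:R * l).
have Qmn : (Q * m <= n)%N.
  rewrite truncn_ge_nat; last by rewrite mulr_ge0// mulr_ge0// ltW.
  by rewrite natrM [8 / u ^+ 2 * Q%:R]mulrC -mulrA ler_wpM2l.
have mE : measurable (experiment (D := D) fstar
    (A := repeat_queries y0 (L eps delta) Q m) eps (n := n)).
  exact: measurable_experiment.
rewrite /extraction_attack -/u -/l -/n; split => //.
  by move=> w ans; exact: repeat_next_halts.
have [d2|d2] := leP (1 / 2) delta.
  by apply: le_trans (measure_ge0 _ _); rewrite lee_fin; lra.
(* Now [delta < 1 / 2], so [Q / delta >= 2] and [8 / u ^+ 2 * l >= 4]; hence [m > 0], and truncation
   costs at most a factor 2. *)
have l2 : 1 / 2 <= l.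
  by apply: ln_ge_half; rewrite ler_pdivlMr// (le_trans _ Q1)//; lra.
have r0 : 0 <= r by rewrite -rhor rho_ge0.
have u1 : u <= 1 by rewrite /u; lra.
have c8 : 8 <= 8 / u ^+ 2.
  by rewrite ler_pdivlMr//; nra.
have m0 : (0 < m)%N by rewrite truncn_gt0; nra.
have failm : (1 - u ^+ 2 / 4) ^+ m <= delta / Q%:R.
  rewrite -[leRHS]invf_div; apply: pow_one_minus_le.
  - by rewrite divr_ge0// ltW.
  - by nra.
  - by rewrite divr_gt0// (lt_le_trans ltr01).
  (* Of the constant 8, a factor 2 pays for the truncation and the remaining 4 cancels against
     [u ^+ 2 / 4]. *)
  rewrite -/l; have -> : l = u ^+ 2 / 4 * (8 / u ^+ 2 * l / 2).
    by field; rewrite gt_eqF.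
  rewrite ler_wpM2l ?divr_ge0 ?(ltW u20)//.
  by apply: truncn_ge_half; nra.
have [mS PS] := Lsucc fstar.
(* One factor for the learner's coins, one for the server's. *)
apply: (@le_trans _ _ ((1 - delta) * (1 - delta))%:E).
  by rewrite lee_fin; nra.
apply: (product_probability_ge mS mE _ _ PS); [lra|lra|].
move=> w Ew; apply: repeat_queries_success => //; first by rewrite rhor.
by rewrite rhor.
Qed.
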